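(* Let $(p_1, \ldots, p_m)$ be an $m$-tuple of real polynomials in $t \in \mathbf{R}^n$, and let $$\Delta(t) = 1 + t_1^2 + \cdots + t_n^2, \quad t \in \mathbf{R}^n.$$ Let $p$ be a real polynomial on $\mathbf{R}^n$. Let $P_1, \ldots, P_m, P$ be the corresponding homogenizations of the polynomials $p_1, \ldots, p_m, p$. Assume that $P(x) > 0$ for all $x \in \bigcap_{k=1}^m P_k^{-1}(\mathbf{R}_+)$, $x \neq 0$. Then there exist an integer $b \geq 0$ and a finite collection of real polynomials in $t, \sqrt{\Delta}$, $\{q_\ell, q_{k\ell}, r_\ell, r_{k\ell}\}$ ($\ell \in L$, $k = 1, \ldots, m$), such that $$\Delta^b p(t) = \sum_{\ell \in L} \left[q_\ell(t, \sqrt{\Delta})^2 + \sqrt{\Delta}\, r_\ell(t, \sqrt{\Delta})^2\right] + \sum_{k=1}^m \sum_{\ell \in L} p_k(t)\left[q_{k\ell}(t, \sqrt{\Delta})^2 + \sqrt{\Delta}\, r_{k\ell}(t, \sqrt{\Delta})^2\right], \quad t \in \mathbf{R}^n,$$ where $\Delta = \Delta(t)$.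
   Context: $n \ge 1$ is a fixed integer; $\mathbf{R}_+ = [0,\infty)$. The homogenization of a polynomial $p$ in $t \in \mathbf{R}^n$ with $\deg(p) = d$ is the homogeneous polynomial $P$ of degree $d$ in $x = (x_0, x_1, \ldots, x_n) \in \mathbf{R}^{n+1}$ determined by $P(x_0, x_1, \ldots, x_n) = x_0^d\, p\!\left(\frac{x_1}{x_0}, \ldots, \frac{x_n}{x_0}\right)$ for $x_0 \neq 0$. A real polynomial in $t, \sqrt{\Delta}$ means a polynomial in $n+1$ variables with real coefficients evaluated at $(t, \sqrt{\Delta(t)})$. *)

(* Defs.v *)
From mathcomp Require Export all_boot all_order all_algebra.
From mathcomp Require Export reals.
From mathcomp Require Export mpoly.

Set Implicit Arguments.
Unset Strict Implicit.
Unset Printing Implicit Defensive.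

Import Order.TTheory GRing.Theory Num.Theory.

Local Open Scope ring_scope.

(* Points of R^n are row vectors; as 'rV[R]_n is a matrix type, a polynomial
   p : {mpoly R[n]} is evaluated at t : 'rV[R]_n by p.@[t ord0].  In R^(n+1)
   the coordinate x_0 is x ord0 ord0 and x_1, ..., x_n are x ord0 (lift ord0 i). *)

Definition total_degree (R : realType) (n : nat) (p : {mpoly R[n]}) : nat :=
  (msize p).-1.

(* For p = 0 the total degree is 0 by convention, and then P = 0. *)
Definition is_homogenization (R : realType) (n : nat)
    (p : {mpoly R[n]}) (P : {mpoly R[n.+1]}) : Prop :=
  P \is (total_degree p).-homog /\
  forall x : 'rV[R]_n.+1, x ord0 ord0 != 0 ->
    P.@[x ord0] =
    x ord0 ord0 ^+ total_degree p *
    p.@[fun i : 'I_n => x ord0 (lift ord0 i) / x ord0 ord0].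

Definition sumsq1 (R : realType) (n : nat) (t : 'rV[R]_n) : R :=
  1 + \sum_(i < n) t ord0 i ^+ 2.

(* The polynomial in t and sqrt Delta given by q; sqrt Delta is substituted
   for the last of the n + 1 variables. *)
Definition eval_sqrt (R : realType) (n : nat) (q : {mpoly R[n + 1]})
    (t : 'rV[R]_n) : R :=
  q.@[(row_mx t (Num.sqrt (sumsq1 t))%:M : 'rV[R]_(n + 1)) ord0].

Definition homog_mnm (n d : nat) (m : 'X_{1..n}) : 'X_{1..n.+1} :=
  [multinom (if unlift ord0 i is Some j then m j else d - mdeg m)%N
  | i < n.+1].

Definition homogenize (R : realType) (n : nat) (p : {mpoly R[n]}) :
    {mpoly R[n.+1]} :=
  \sum_(m <- msupp p) p@_m *: 'X_[homog_mnm (total_degree p) m].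

Lemma mdeg_le_total_degree (R : realType) n (p : {mpoly R[n]}) m :
  m \in msupp p -> (mdeg m <= total_degree p)%N.
Proof.
by move=> /msize_mdeg_lt; rewrite /total_degree; case: (msize p).
Qed.

Lemma homog_mnm0 n d (m : 'X_{1..n}) : homog_mnm d m ord0 = (d - mdeg m)%N.
Proof. by rewrite mnmE unlift_none. Qed.

Lemma homog_mnmS n d (m : 'X_{1..n}) i : homog_mnm d m (lift ord0 i) = m i.
Proof. by rewrite mnmE liftK. Qed.

Lemma homogenizeP (R : realType) n (p : {mpoly R[n]}) :
  is_homogenization p (homogenize p).
Proof.
split.
  rewrite /homogenize big_seq; apply: rpred_sum => m mp.
  apply: dhomogZ; rewrite dhomogX; apply/eqP.
  rewrite /= [LHS]mdegE big_ord_recl homog_mnm0.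
  rewrite (eq_bigr (fun i => m i)) => [|i _]; last exact: homog_mnmS.
  by rewrite -mdegE subnK // mdeg_le_total_degree.
move=> x x0; rewrite /homogenize raddf_sum /= mevalE mulr_sumr !big_seq.
apply: eq_bigr => m mp.
set c := x ord0 ord0; set d := total_degree p.
set A := \prod_(i < n) x ord0 (lift ord0 i) ^+ m i.
have -> : \prod_(i < n) (x ord0 (lift ord0 i) / c) ^+ m i = A / c ^+ mdeg m.
  rewrite (eq_bigr (fun i => x ord0 (lift ord0 i) ^+ m i / c ^+ m i)).
    by rewrite big_split /= prodfV prodrXr -mdegE.
  by move=> i _; rewrite exprMn exprVn.
rewrite mevalZ mevalX big_ord_recl homog_mnm0.
rewrite (eq_bigr (fun i => x ord0 (lift ord0 i) ^+ m i)); last first.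
  by move=> i _; rewrite homog_mnmS.
rewrite -/c -/A expfB_cond ?(negbTE x0) ?mdeg_le_total_degree //.
by rewrite [RHS]mulrCA; congr (_ * _); rewrite mulrAC mulrA.
Qed.

Lemma poly_vanish (R : realType) (f : {poly R}) :
  (forall s, f.[s] = 0) -> f = 0.
Proof.
move=> f0; apply/eqP/negPn/negP => fn0.
have := @max_poly_roots _ f [seq i%:R : R | i <- iota 0 (size f)] fn0.
rewrite size_map size_iota ltnn => /(_ _ _)/negP; apply => //.
  by apply/allP => s _; apply/rootP.
rewrite map_inj_uniq ?iota_uniq // => i j /eqP.
by rewrite eqr_nat => /eqP.
Qed.

Lemma mpoly_vanish (R : realType) n (p : {mpoly R[n]}) :
  (forall v : 'I_n -> R, p.@[v] = 0) -> p = 0.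
Proof.
elim: n p => [|n IHn] p p0.
  by rewrite (nvar0_mpolyC p); move: (p0 (fun=> 0));
     rewrite {1}(nvar0_mpolyC p) mevalC => ->.
pose tl (m : 'X_{1..n.+1}) : 'X_{1..n} := [multinom m (lift ord0 i) | i < n].
pose q k : {mpoly R[n]} :=
  \sum_(m <- msupp p | m ord0 == k) p@_m *: 'X_[tl m].
have q0 k : q k = 0.
  apply: IHn => w.
  pose f : {poly R} :=
    \sum_(m <- msupp p) (p@_m * \prod_(i < n) w i ^+ m (lift ord0 i)) *:
      'X^(m ord0).
  have f0 : f = 0.
    apply: poly_vanish => s.
    rewrite -(p0 (fun i => if unlift ord0 i is Some j then w j else s)).
    rewrite /f horner_sum mevalE; apply: eq_bigr => m _.
    rewrite hornerZ hornerXn big_ord_recl unlift_none -mulrA; congr (_ * _).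
    by rewrite mulrC; under [in RHS]eq_bigr do rewrite liftK.
  transitivity f`_k; last by rewrite f0 coef0.
  rewrite /q /f raddf_sum coef_sum big_mkcond /=; apply: eq_bigr => m _.
  rewrite coefZ coefXn eq_sym; case: eqP => _; rewrite ?mulr0 // mulr1.
  rewrite mevalZ mevalX; congr (_ * _).
  by apply: eq_bigr => i _; rewrite mnmE.
apply/mpolyP => m0; rewrite mcoeff0.
have := congr1 (mcoeff (tl m0)) (q0 (m0 ord0)); rewrite mcoeff0 => <-.
have tlE (m : 'X_{1..n.+1}) :
    (m ord0 == m0 ord0) && (tl m == tl m0) = (m == m0).
  apply/andP/eqP => [[/eqP e0 /eqP e]|-> //].
  apply/mnmP => i; case: (unliftP ord0 i) => [j|] -> //.
  by move/mnmP: e => /(_ j); rewrite !mnmE.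
rewrite /q raddf_sum /= big_mkcond /=.
transitivity (\sum_(m <- msupp p) if m == m0 then p@_m0 else 0).
  rewrite -big_mkcond /=; case: (boolP (m0 \in msupp p)) => mp.
    by rewrite (big_rem m0) //= eqxx big_seq_cond big1 ?addr0 // => m /andP[];
       rewrite mem_rem_uniq ?msupp_uniq // inE => /andP[/negbTE ->].
  rewrite (memN_msupp_eq0 mp) big_seq_cond big1 // => m /andP[].
apply: eq_bigr => m _; have := tlE m.
case: (m =P m0) => [-> _|_].
  by rewrite eqxx mcoeffZ mcoeffX eqxx mulr1.
case: (m ord0 == m0 ord0) => //= tlF.
by rewrite mcoeffZ mcoeffX tlF mulr0.
Qed.

Lemma is_homogenization_uniq (R : realType) n (p : {mpoly R[n]})
    (P Q : {mpoly R[n.+1]}) :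
  is_homogenization p P -> is_homogenization p Q -> P = Q.
Proof.
move=> [_ hP] [_ hQ]; apply/eqP; rewrite -subr_eq0.
have /eqP : ('X_ord0 : {mpoly R[n.+1]}) * (P - Q) = 0.
  apply: mpoly_vanish => v; rewrite mevalM mevalXU mevalB.
  have [->|v0] := eqVneq (v ord0) 0; first by rewrite mul0r.
  pose x : 'rV[R]_n.+1 := \row_i v i.
  have xv : x ord0 =1 v by move=> i; rewrite mxE.
  have x0 : x ord0 ord0 != 0 by rewrite xv.
  by rewrite -!(meval_eq _ xv) hP // hQ // subrr mulr0.
rewrite mulf_eq0 => /orP[|//] /eqP/mpolyP/(_ U_(ord0)%MM)/eqP.
by rewrite mcoeffX eqxx mcoeff0 oner_eq0.
Qed.

(* Main.v *)
(* Put x(t) = (1, t) / sqrt Delta, a point of the unit sphere of R^(n+1).  If P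
   has degree d then sqrt Delta ^ d * P(x(t)) = p(t).  The polynomials a for
   which sqrt Delta ^ N * a(x(t)) has the required form for all large N are a
   quadratic module which contains the P_k and both signs of 1 - |x|^2, hence is
   archimedean; parity of N is harmless since sqrt Delta times
   q^2 + sqrt Delta r^2 is (sqrt Delta r)^2 + sqrt Delta q^2.  So the claim
   follows from Putinar's Positivstellensatz.  For the latter (after Jacobi), if
   f is positive at all points where the archimedean module M is nonnegative,
   then M - sum_of_squares * f contains -1: otherwise Zorn's lemma extends it to
   a maximal proper quadratic module, which is the set of polynomials
   nonnegative at some point up to infinitesimals.  This gives s * f - 1 in M
   with s a sum of squares, and a descent on r for f + r in M ends with f in M. *)
From mathcomp Require Import boolp classical_sets ring lra.
Require Import Defs.

Set Implicit Arguments.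
Unset Strict Implicit.
Unset Printing Implicit Defensive.

Import Order.TTheory GRing.Theory Num.Theory.

Local Open Scope ring_scope.

(** * Quadratic modules in a commutative ring, and maximal ones *)

Definition quadratic_module (A : comNzRingType) (M : A -> Prop) : Prop :=
  [/\ M 1, forall a b, M a -> M b -> M (a + b)
    & forall u a, M a -> M (u ^+ 2 * a)].

Definition sum_of_squares (A : comNzRingType) (s : A) : Prop :=
  exists us : seq A, s = \sum_(u <- us) u ^+ 2.

(** For a quadratic module [M], this is the quadratic module generated by [M] and [g]. It may
    contain -1, since [quadratic_module] does not demand properness. *)
Definition adjoin (A : comNzRingType) (M : A -> Prop) (g : A) : A -> Prop :=
  fun a => exists b s, [/\ M b, sum_of_squares s & a = b + s * g].

(** Only upper bounds are asked for: applied to [- a], the condition also bounds [a] from below. *)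
Definition archimedean (R : realType) (A : comNzRingType)
    (c : {rmorphism R -> A}) (M : A -> Prop) : Prop :=
  forall a, exists N : R, M (c N - a).

Section QuadraticModule.
Variables (A : comNzRingType) (M : A -> Prop).
Hypothesis qM : quadratic_module M.

Lemma qmodule1 : M 1. Proof. by case: qM. Qed.

Lemma qmoduleD a b : M a -> M b -> M (a + b). Proof. by case: qM => _ + _; apply. Qed.

Lemma qmoduleM u a : M a -> M (u ^+ 2 * a). Proof. by case: qM => _ _; apply. Qed.

Lemma qmodule_sqr u : M (u ^+ 2).
Proof. by rewrite -[u ^+ 2]mulr1; apply: qmoduleM qmodule1. Qed.

Lemma qmodule0 : M 0.
Proof. by have := qmodule_sqr 0; rewrite expr0n. Qed.

Lemma qmodule_sosM s a : sum_of_squares s -> M a -> M (s * a).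
Proof.
move=> [us ->] Ma; elim: us => [|u us IH].
  by rewrite big_nil mul0r; apply: qmodule0.
by rewrite big_cons mulrDl; apply: qmoduleD => //; apply: qmoduleM.
Qed.

Lemma qmodule_sos s : sum_of_squares s -> M s.
Proof. by move=> /qmodule_sosM/(_ qmodule1); rewrite mulr1. Qed.

Lemma qmodule_adjoin g : quadratic_module (adjoin M g).
Proof.
split.
- exists 1, 0; split; [exact: qmodule1 | by exists [::]; rewrite big_nil |].
  by rewrite mul0r addr0.
- move=> _ _ [a [s [Ma [us ->] ->]]] [b [s' [Mb [vs ->] ->]]].
  exists (a + b), (\sum_(u <- us ++ vs) u ^+ 2); split; first exact: qmoduleD.
    by exists (us ++ vs).
  by rewrite big_cat /=; ring.
- move=> v _ [a [s [Ma [us ->] ->]]].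
  exists (v ^+ 2 * a), (\sum_(u <- [seq v * u | u <- us]) u ^+ 2); split.
  + exact: qmoduleM.
  + by exists [seq v * u | u <- us].
  + rewrite big_map mulrDr mulrA mulr_sumr; congr (_ + _ * _).
    by apply: eq_bigr => u _; rewrite exprMn.
Qed.

Lemma sub_adjoin g a : M a -> adjoin M g a.
Proof.
by exists a, 0; split => //; [exists [::]; rewrite big_nil | rewrite mul0r addr0].
Qed.

Lemma mem_adjoin g : adjoin M g g.
Proof.
exists 0, 1; split; [exact: qmodule0 | | by rewrite add0r mul1r].
by exists [:: 1]; rewrite big_seq1 expr1n.
Qed.

(** Zorn's lemma on the quadratic modules that contain [M] and avoid -1. The union bounds a nonempty
    chain, and [M] itself bounds the empty one. *)
Lemma maximal_qmodule : ~ M (-1) ->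
  exists Q, [/\ quadratic_module Q, forall a, M a -> Q a, ~ Q (-1)
    & forall Q', quadratic_module Q' -> (forall a, Q a -> Q' a) ->
      ~ Q' (-1) -> forall a, Q' a -> Q a].
Proof.
move=> M1.
pose T := {Q : A -> Prop |
  [/\ quadratic_module Q, forall a, M a -> Q a & ~ Q (-1)]}.
have t0 : T by exists M; split.
pose le (x y : T) : bool := `[< forall a, sval x a -> sval y a >].
have le_refl x : le x x by apply/asboolP.
have le_trans x y z : le x y -> le y z -> le x z.
  by move=> /asboolP xy /asboolP yz; apply/asboolP => a /xy/yz.
have [|t tmax] := ZL_preorder t0 le_refl le_trans.
  move=> C Ctot; have [[x0 Cx0]|C0] := pselect (exists x, C x); last first.
    by exists t0 => s Cs; case: C0; exists s.
  pose U a := exists2 x, C x & sval x a.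
  have qU : [/\ quadratic_module U, forall a, M a -> U a & ~ U (-1)].
    split; last by move=> [x _]; case: (svalP x).
      split.
      - by exists x0 => //; case: (svalP x0) => -[].
      - move=> a b [x Cx xa] [y Cy yb].
        have [/asboolP xy|/asboolP yx] := Ctot _ _ Cx Cy.
          by exists y => //; case: (svalP y) => -[_ + _ _ _]; apply=> //; apply: xy.
        by exists x => //; case: (svalP x) => -[_ + _ _ _]; apply=> //; apply: yx.
      - move=> u a [x Cx xa]; exists x => //.
        by case: (svalP x) => -[_ _ + _ _]; apply.
    by move=> a Ma; exists x0 => //; case: (svalP x0) => _ + _; apply.
  exists (exist _ U qU) => s Cs; apply/asboolP => a sa /=; by exists s.
case: t tmax => Q [qQ MQ Q1] tmax; exists Q; split=> // Q' qQ' QQ' Q'1 a Q'a.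
have qT : [/\ quadratic_module Q', forall a, M a -> Q' a & ~ Q' (-1)].
  by split=> // b /MQ/QQ'.
have /asboolP := tmax (exist _ Q' qT) (introT (asboolP _) QQ').
exact.
Qed.

End QuadraticModule.

(** * Real constants: totality, standard parts, bounded elements and descent *)

Section Archimedean.
Variables (R : realType) (A : comNzRingType) (c : {rmorphism R -> A}).

Lemma qmodule_const (M : A -> Prop) (r : R) :
  quadratic_module M -> 0 <= r -> M (c r).
Proof.
by move=> qM r0; rewrite -(sqr_sqrtr r0) rmorphXn; apply: qmodule_sqr.
Qed.

Lemma qmoduleZ (M : A -> Prop) (r : R) a :
  quadratic_module M -> 0 <= r -> M a -> M (c r * a).
Proof.
by move=> qM r0; rewrite -(sqr_sqrtr r0) rmorphXn; apply: qmoduleM.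
Qed.

Lemma qmodule_neg_const (M : A -> Prop) (r : R) :
  quadratic_module M -> r < 0 -> M (c r) -> M (-1).
Proof.
move=> qM r0 /(@qmoduleZ _ (- r^-1) _ qM); rewrite oppr_ge0 invr_le0 ltW //.
by move=> /(_ isT); rewrite -rmorphM mulNr mulVf ?lt_eqF // rmorphN rmorph1.
Qed.

Lemma half_double : c 2^-1 + c 2^-1 = 1.
Proof. by rewrite -rmorphD -(rmorph1 c); congr (c _); field. Qed.

(** From 4 b = (b + 1)^2 - (b - 1)^2. It reduces multiplication by an arbitrary [b] to
    multiplication by squares, under which quadratic modules are closed. *)
Lemma qmodule_polarize (a b : A) :
  b * a = (c 2^-1 * (b + 1)) ^+ 2 * a + (c 2^-1 * (b - 1)) ^+ 2 * (- a).
Proof.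
have := half_double; set h := c _ => e.
have -> : b * a = (h + h) ^+ 2 * b * a by rewrite e; ring.
by ring.
Qed.

Lemma qmodule_support (M : A -> Prop) a b :
  quadratic_module M -> M a -> M (- a) -> M (b * a).
Proof.
move=> qM Ma MNa; rewrite qmodule_polarize.
by apply: qmoduleD => //; apply: qmoduleM.
Qed.

(** If both fail, maximality gives -1 = m1 + s1 a and -1 = m2 - s2 a. Eliminating a yields - s1 = s2
    + s2 m1 + s1 m2, which lies in Q. So s1 and - s1 both lie in Q, hence so does s1 a by
    [qmodule_support], and then -1 = m1 + s1 a. *)
Lemma maximal_qmodule_total (Q : A -> Prop) : quadratic_module Q -> ~ Q (-1) ->
  (forall Q', quadratic_module Q' -> (forall a, Q a -> Q' a) ->
     ~ Q' (-1) -> forall a, Q' a -> Q a) ->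
  forall a, Q a \/ Q (- a).
Proof.
move=> qQ Q1 Qmax a; apply: contrapT => /not_orP[nQa nQNa].
have adj1 g : ~ Q g -> adjoin Q g (-1).
  move=> nQg; apply: contrapT => h1; apply: nQg.
  apply: (Qmax (adjoin Q g)) => //; [exact: qmodule_adjoin | | exact: mem_adjoin].
  by move=> b; apply: sub_adjoin.
have [m1 [s1 [Qm1 Ss1 e1]]] := adj1 _ nQa.
have [m2 [s2 [Qm2 Ss2 e2]]] := adj1 _ nQNa.
have QNs1 : Q (- s1).
  have -> : - s1 = s2 + (s2 * m1 + s1 * m2).
    have -> : s2 + (s2 * m1 + s1 * m2) = - s1 + s1 * (m2 + s2 * - a - (-1))
       + s2 * (m1 + s1 * a - (-1)) by ring.
    by rewrite -e1 -e2; ring.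
  apply: qmoduleD => //; first exact: qmodule_sos.
  by apply: qmoduleD => //; apply: qmodule_sosM.
apply: Q1; rewrite e1; apply: qmoduleD => //.
by rewrite mulrC; apply: qmodule_support => //; apply: qmodule_sos.
Qed.

Definition infinitesimal (Q : A -> Prop) (a : A) : Prop :=
  forall e : R, 0 < e -> Q (c e + a) /\ Q (c e - a).

(** Take r to be the supremum of the reals with [a - c r] in [Q]. The archimedean property and
    properness make this set nonempty and bounded above. Above the supremum, totality puts the
    opposite difference in [Q]. *)
Lemma standard_part (Q : A -> Prop) : quadratic_module Q -> ~ Q (-1) ->
  (forall a, Q a \/ Q (- a)) -> archimedean c Q ->
  forall a, exists r : R, infinitesimal Q (a - c r).
Proof.
move=> qQ Q1 Qtot Qarch a.
pose E := (fun r : R => Q (a - c r)) : set R.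
have Esup : has_sup E.
  have [N QN] := Qarch a; have [N' QN'] := Qarch (- a).
  split; first by exists (- N'); rewrite /E rmorphN addrC opprK -[a]opprK.
  exists N => r Er; rewrite leNgt; apply/negP => Nr; apply: Q1.
  apply: (@qmodule_neg_const _ (N - r)) => //; first by rewrite subr_lt0.
  by rewrite rmorphB -(subrKA a); apply: qmoduleD.
exists (sup E) => e e0; split.
  have [r Er lr] := sup_adherent e0 Esup.
  have -> : c e + (a - c (sup E)) = (a - c r) + c (r - (sup E - e)).
    by rewrite !rmorphB; ring.
  by apply: qmoduleD => //; apply: qmodule_const => //; rewrite subr_ge0 ltW.
have [Er|] := Qtot (a - c (sup E + e)).
  by have := sup_upper_bound Esup Er; rewrite gerDl leNgt e0.
by congr Q; rewrite rmorphD; ring.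
Qed.

Section Infinitesimal.
Variable Q : A -> Prop.
Hypotheses (qQ : quadratic_module Q) (Qarch : archimedean c Q).

Lemma infinitesimalD a b :
  infinitesimal Q a -> infinitesimal Q b -> infinitesimal Q (a + b).
Proof.
move=> Ia Ib e e0; have e20 : 0 < e * 2^-1 by rewrite divr_gt0.
have [a1 a2] := Ia _ e20; have [b1 b2] := Ib _ e20.
have -> : c e = c (e * 2^-1) + c (e * 2^-1) by rewrite -rmorphD; congr (c _); field.
split; first by rewrite addrACA; apply: qmoduleD.
by rewrite opprD addrACA; apply: qmoduleD.
Qed.

Lemma infinitesimalN a : infinitesimal Q a -> infinitesimal Q (- a).
Proof. by move=> Ia e /Ia[]; rewrite opprK. Qed.

Lemma infinitesimal0 : infinitesimal Q 0.
Proof. by move=> e /ltW e0; rewrite oppr0 !addr0; split; apply: qmodule_const. Qed.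

(* With b ^+ 2 <= N, the bound |a| <= e gives |b ^+ 2 * a| <= e * N. *)
Lemma infinitesimal_sqrM a b : infinitesimal Q a -> infinitesimal Q (b ^+ 2 * a).
Proof.
move=> Ia e e0; have [N0 QN0] := Qarch (b ^+ 2).
pose N := Num.max N0 1.
have QN : Q (c N - b ^+ 2).
  have -> : c N - b ^+ 2 = c (N - N0) + (c N0 - b ^+ 2) by rewrite rmorphB; ring.
  by apply: qmoduleD => //; apply: qmodule_const => //; rewrite subr_ge0 le_max lexx.
have N_gt0 : 0 < N by rewrite lt_max ltr01 orbT.
have d0 : 0 < e / N by rewrite divr_gt0.
have [a1 a2] := Ia _ d0.
have -> : c e = c (e / N) * c N by rewrite -rmorphM divfK ?gt_eqF.
have E s : c (e / N) * c N + s * (b ^+ 2 * a) =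
    c (e / N) * (c N - b ^+ 2) + b ^+ 2 * (c (e / N) + s * a) by ring.
rewrite -[X in _ + X](mul1r (_ * _)) -[X in Q (_ * _ - X)](mul1r (_ * _)) -mulNr !E.
rewrite mul1r mulN1r; split; apply: qmoduleD => //; try exact: qmoduleM;
  apply: qmoduleZ => //; exact: ltW.
Qed.

Lemma infinitesimalM a b : infinitesimal Q a -> infinitesimal Q (b * a).
Proof.
move=> Ia; rewrite qmodule_polarize.
by apply: infinitesimalD; apply: infinitesimal_sqrM => //; apply: infinitesimalN.
Qed.

(** If r were negative, the bound e = - r / 2 would put (e - (a - r)) + a = r / 2, a negative
    constant, in [Q]. *)
Lemma infinitesimal_const_ge0 a r : ~ Q (-1) ->
  Q a -> infinitesimal Q (a - c r) -> 0 <= r.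
Proof.
move=> Q1 Qa Ia; rewrite leNgt; apply/negP => r0; apply: Q1.
have r20 : 0 < - r / 2 by rewrite divr_gt0 ?oppr_gt0.
have [_ h] := Ia _ r20.
apply: (@qmodule_neg_const _ (r / 2)) => //; first by rewrite pmulr_llt0 // invr_gt0.
have -> : r / 2 = - r / 2 + r by field.
have -> : c (- r / 2 + r) = (c (- r / 2) - (a - c r)) + a by rewrite rmorphD; ring.
exact: qmoduleD.
Qed.

End Infinitesimal.

(** The bounded elements form a subring although [M] need not be closed under products: squares are
    bounded through 2 K (K^2 - a^2) = (K - a)^2 (K + a) + (K + a)^2 (K - a), and products follow
    from 2 a b = (a + b)^2 - a^2 - b^2. *)
Lemma archimedean_closed (M : A -> Prop) (B := fun a => exists N : R,
    0 <= N /\ (M (c N - a) /\ M (c N + a))) : quadratic_module M ->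
  [/\ forall r, B (c r), forall a b, B a -> B b -> B (a + b)
    & forall a b, B a -> B b -> B (a * b)].
Proof.
move=> qM.
have BD a b : B a -> B b -> B (a + b).
  move=> [N [N0 [a1 a2]]] [N' [N'0 [b1 b2]]]; exists (N + N'); split; first lra.
  rewrite rmorphD; split; last by rewrite addrACA; apply: qmoduleD.
  by rewrite opprD addrACA; apply: qmoduleD.
have Bc r : B (c r).
  exists `|r|; split => //; rewrite -rmorphB -rmorphD.
  have := ler_norm r; have := lerNnormlW (lexx `|r|) => h1 h2.
  by split; apply: qmodule_const => //; lra.
have BZ r a : B a -> B (c r * a).
  move=> [N [N0 [a1 a2]]]; exists (`|r| * N); split; first exact: mulr_ge0.
  rewrite rmorphM; have [r0|r0] := ler0P r; last first.
    by rewrite -mulrBr -mulrDr; split; apply: qmoduleZ => //; apply: ltW.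
  have -> : c r * a = - (c (- r) * a) by rewrite rmorphN mulNr opprK.
  rewrite opprK -mulrBr -mulrDr; split; apply: qmoduleZ => //; lra.
have Bsqr a : B a -> B (a ^+ 2).
  move=> [N [N0 [a1 a2]]].
  (* The bound is raised by 1 because the identity for squares divides by [K + K]. *)
  have {a1 a2 N0} [K [K0 a1 a2]] : exists K, [/\ 0 < K, M (c K - a) & M (c K + a)].
    exists (N + 1); rewrite rmorphD rmorph1 !(addrAC _ 1).
    by split; [lra | |]; apply: qmoduleD => //; apply: qmodule1.
  exists (K ^+ 2); split; first exact: sqr_ge0.
  split; last by apply: qmoduleD; rewrite ?rmorphXn //; apply: qmodule_sqr.
  have -> : c (K ^+ 2) - a ^+ 2 =
      c ((K + K)^-1) * ((c K - a) ^+ 2 * (c K + a) + (c K + a) ^+ 2 * (c K - a)).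
    have e : c (K + K)^-1 * (c K + c K) = 1.
      by rewrite -rmorphD -rmorphM mulVf ?rmorph1 // gt_eqF // addr_gt0.
    rewrite rmorphXn; set k := c K; set h := c _.
    have -> : k ^+ 2 - a ^+ 2 = (h * (k + k)) * (k ^+ 2 - a ^+ 2) by rewrite e mul1r.
    ring.
  apply: qmoduleZ => //; first by rewrite invr_ge0; lra.
  by apply: qmoduleD => //; apply: qmoduleM.
split => // a b Ba Bb.
have -> : a * b = c (2^-1) * (a + b) ^+ 2 + c (- 2^-1) * (a ^+ 2 + b ^+ 2).
  have e := half_double; rewrite rmorphN; set h := c _ in e *.
  have -> : a * b = (h + h) * (a * b) by rewrite e mul1r.
  ring.
by apply/BD; apply/BZ; [apply/Bsqr/BD | apply/BD; apply/Bsqr].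
Qed.

(* If s * f - 1 lies in M and f + r lies in M, so does f + r - 1 / k for every
   k large enough to dominate s / 2 and s ^+ 2 * f; iterating brings r below 0. *)
Lemma qmodule_descent (M : A -> Prop) f s : quadratic_module M ->
  archimedean c M -> sum_of_squares s -> M (s * f - 1) -> M f.
Proof.
move=> qM March Ss Msf.
have [K1 MK1] := March s; have [K2 MK2] := March (s ^+ 2 * f).
have [K3 MK3] := March (- f).
pose k := `|K1| + `|K2| + 1.
have k0 : 0 < k by rewrite ltr_wpDl // addr_ge0.
have up N K a : N <= K -> M (c N - a) -> M (c K - a).
  move=> NK MN; have -> : c K - a = c (K - N) + (c N - a) by rewrite rmorphB; ring.
  by apply: qmoduleD => //; apply: qmodule_const => //; rewrite subr_ge0.
have h1 : M (c (2 * k) - s).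
  apply: up MK1; rewrite /k; have := ler_norm K1.
  by have := normr_ge0 K1; have := normr_ge0 K2; lra.
have h2 : M (c k - s ^+ 2 * f).
  apply: up MK2; rewrite /k; have := ler_norm K2; have := normr_ge0 K1; lra.
have step r : 0 <= r -> M (f + c r) -> M (f + c (r - k^-1)).
  move=> r0 Mr.
  (* The last three summands cancel the terms in s f, s^2 f, r s and r s^2 of (k - s)^2 (f + r).
     What remains is k^2 (f + r) - k. *)
  have -> : f + c (r - k^-1) = c (k^-1 ^+ 2) * ((c k - s) ^+ 2 * (f + c r)
     + c (2 * k) * (s * f - 1) + (c k - s ^+ 2 * f) + c r * (s * (c (2 * k) - s))).
    have e : c k^-1 * c k = 1 by rewrite -rmorphM mulVf ?rmorph1 // gt_eqF.
    rewrite rmorphB rmorphXn rmorphM [c 2]rmorph_nat; set h := c k^-1 in e *.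
    transitivity ((h * c k) ^+ 2 * (f + c r) - h * (h * c k)); first by rewrite e; ring.
    ring.
  apply: qmoduleZ => //; first exact: sqr_ge0.
  apply: qmoduleD => //; last first.
    by apply: qmoduleZ => //; apply: qmodule_sosM.
  apply: qmoduleD => //; apply: qmoduleD => //; first exact: qmoduleM.
  by apply: qmoduleZ => //; rewrite mulr_ge0 // ltW.
(* [step] requires a nonnegative constant. Once the constant is negative, [M f] follows by adding
   its opposite, hence the disjunction. *)
have iter j : M f \/ M (f + c (`|K3| - j%:R / k)).
  elim: j => [|j [Mf|IH]]; [right | by left |].
    rewrite mul0r subr0 addrC -[X in c _ + X]opprK; apply: up MK3; exact: ler_norm.
  have [r0|r0] := lerP 0 (`|K3| - j%:R / k).
    right; have := step _ r0 IH; congr (M (_ + c _)).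
    by rewrite -natr1; field; rewrite gt_eqF.
  left; set r := `|K3| - _ in IH r0.
  have -> : f = (f + c r) + c (- r) by rewrite rmorphN addrK.
  by apply: qmoduleD => //; apply: qmodule_const => //; lra.
have [//|Mj] := iter (Num.bound (`|K3| * k)).
set r := `|K3| - _ in Mj.
have -> : f = (f + c r) + c (- r) by rewrite rmorphN addrK.
apply: qmoduleD => //; apply: qmodule_const => //; rewrite /r opprB subr_ge0.
rewrite ler_pdivlMr //; apply/ltW/archi_boundP/mulr_ge0 => //; exact: ltW.
Qed.

End Archimedean.

(** * Archimedean quadratic modules of polynomials and Putinar's theorem *)

Section PolynomialModule.
Variables (R : realType) (n : nat).
Implicit Types (a f : {mpoly R[n]}) (M : {mpoly R[n]} -> Prop).

(** Induction along ring generators suits the bounded elements, evaluation modulo infinitesimals,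
    and the clearing of denominators on the sphere. *)
Lemma mpoly_ring_ind (B : {mpoly R[n]} -> Prop) :
  (forall r : R, B r%:MP) -> (forall i, B 'X_i) ->
  (forall a b, B a -> B b -> B (a + b)) ->
  (forall a b, B a -> B b -> B (a * b)) -> forall a, B a.
Proof.
move=> Bc BX BD BM; elim/mpolyind => [|r m a _ _ Ba]; first by rewrite -mpolyC0.
apply: (BD) => //; rewrite -mul_mpolyC; apply: (BM) => //; rewrite mpolyXE_id.
apply: (big_ind B) => [||i _]; [by rewrite -mpolyC1 | exact: BM |].
by elim: (m i) => [|k IH]; rewrite ?expr0 -?mpolyC1 // exprS; apply: (BM).
Qed.

(** As bounded elements form a subring, it suffices to bound each variable. Adding the other squares
    gives 1 - X_i^2 in [M], and 2 (1 + x) = (1 + x)^2 + (1 - x^2) with x = X_i or - X_i turns this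
    into linear bounds. *)
Lemma ball_archimedean M : quadratic_module M ->
  M (1 - \sum_(i < n) 'X_i ^+ 2) -> archimedean (@mpolyC n R) M.
Proof.
move=> qM Mball; have [Bc BD BM] := archimedean_closed (@mpolyC n R) qM.
have M1X i : M (1 - 'X_i ^+ 2).
  have -> : 1 - 'X_i ^+ 2 =
      (1 - \sum_(j < n) 'X_j ^+ 2) + \sum_(j < n | j != i) 'X_j ^+ 2 :> {mpoly R[n]}.
    by rewrite (bigD1 i) //=; ring.
  apply: qmoduleD => //; apply: (big_ind M) => [|a b|j _].
  - exact: qmodule0.
  - exact: qmoduleD.
  - exact: qmodule_sqr.
have half_sqr (x : {mpoly R[n]}) : M (1 - x ^+ 2) -> M (1 + x).
  move=> Mx; have -> : 1 + x = (2^-1)%:MP * ((1 + x) ^+ 2 + (1 - x ^+ 2)).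
    transitivity (((2^-1)%:MP + (2^-1)%:MP) * (1 + x)); last by ring.
    by rewrite half_double mul1r.
  by apply: qmoduleZ; rewrite ?invr_ge0 //; apply: qmoduleD => //; apply: qmodule_sqr.
move=> a.
have [|N [_ [Ma _]]] := @mpoly_ring_ind _ Bc _ BD BM a; last by exists N.
move=> i; exists 1; split => //; rewrite rmorph1; split; apply: half_sqr => //.
by rewrite sqrrN.
Qed.

(* A maximal quadratic module avoiding -1 is total, and modulo its
   infinitesimals every polynomial is the constant given by evaluation at the
   point formed by the standard parts of the variables. *)
Theorem archimedean_positivstellensatz M f : quadratic_module M ->
  archimedean (@mpolyC n R) M ->
  (forall v : 'I_n -> R, (forall a, M a -> 0 <= a.@[v]) -> 0 < f.@[v]) ->
  M f.
Proof.
move=> qM March fpos.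
(* From -1 = b - s f one reads off s f - 1 = b in [M], which is the input of the descent. *)
suff [b [s [Mb Ss e]]] : adjoin M (- f) (-1).
  apply: (qmodule_descent qM March Ss).
  by have -> : s * f - 1 = b by rewrite e; ring.
apply: contrapT => M1; have qMf := qmodule_adjoin qM (- f).
have [Q [qQ MQ Q1 Qmax]] := maximal_qmodule qMf M1.
have Qtot := maximal_qmodule_total (@mpolyC n R) qQ Q1 Qmax.
have Qarch : archimedean (@mpolyC n R) Q.
  by move=> a; have [N MN] := March a; exists N; apply/MQ/sub_adjoin.
have std := standard_part qQ Q1 Qtot Qarch.
pose v i := projT1 (cid (std 'X_i)).
have evalP a : infinitesimal (@mpolyC n R) Q (a - (a.@[v])%:MP).
  elim/mpoly_ring_ind: a => [r|i|a b Ia Ib|a b Ia Ib].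
  - by rewrite mevalC subrr; apply: infinitesimal0.
  - by rewrite mevalXU; apply: (projT2 (cid (std 'X_i))).
  - by rewrite mevalD mpolyCD opprD addrACA; apply: infinitesimalD.
  - rewrite mevalM mpolyCM.
    have -> : a * b - (a.@[v])%:MP * (b.@[v])%:MP =
      b * (a - (a.@[v])%:MP) + (a.@[v])%:MP * (b - (b.@[v])%:MP) by ring.
    by apply: infinitesimalD => //; apply: infinitesimalM.
have Qv a : Q a -> 0 <= a.@[v].
  by move=> Qa; apply: infinitesimal_const_ge0 qQ _ _ Q1 Qa (evalP a).
have := fpos v (fun a Ma => Qv _ (MQ _ (sub_adjoin _ Ma))).
have := Qv _ (MQ _ (mem_adjoin qM _)); rewrite mevalN oppr_ge0.
by move=> /le_lt_trans h /h; rewrite ltxx.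
Qed.

End PolynomialModule.

(** * Transfer between the sphere and polynomials in t and sqrt Delta *)

Section Sphere.
Variables (R : realType) (n m : nat) (ps : 'I_m -> {mpoly R[n]}).
Implicit Types (t : 'rV[R]_n) (F G : 'rV[R]_n -> R).

Definition sqrt_delta t : R := Num.sqrt (sumsq1 t).

Lemma sumsq1_gt0 t : 0 < sumsq1 t.
Proof. by rewrite ltr_pwDl // sumr_ge0 // => i _; apply: sqr_ge0. Qed.

Lemma sqrt_delta_neq0 t : sqrt_delta t != 0.
Proof. by rewrite gt_eqF // sqrtr_gt0 sumsq1_gt0. Qed.

Lemma sqrt_delta_sqr t : sqrt_delta t ^+ 2 = sumsq1 t.
Proof. by rewrite sqr_sqrtr // ltW // sumsq1_gt0. Qed.

Definition sphere_point t : 'rV[R]_n.+1 :=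
  \row_i ((if unlift ord0 i is Some j then t ord0 j else 1) / sqrt_delta t).

Lemma sphere_point0 t : sphere_point t ord0 ord0 = (sqrt_delta t)^-1.
Proof. by rewrite mxE unlift_none mul1r. Qed.

Lemma sphere_pointS t i : sphere_point t ord0 (lift ord0 i) = t ord0 i / sqrt_delta t.
Proof. by rewrite mxE liftK. Qed.

Lemma sphere_point_norm t : \sum_i sphere_point t ord0 i ^+ 2 = 1.
Proof.
rewrite big_ord_recl sphere_point0.
under eq_bigr do rewrite sphere_pointS exprMn.
rewrite -mulr_suml exprVn -[X in X + _]mul1r -mulrDl sqrt_delta_sqr divff //.
by rewrite gt_eqF // sumsq1_gt0.
Qed.

(** On [sphere_point t] the coordinate x_0 is 1 / sqrt Delta and the ratios x_i / x_0 are the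
    t_i. *)
Lemma homogenization_sphere (p : {mpoly R[n]}) (P : {mpoly R[n.+1]}) t :
  is_homogenization p P ->
  sqrt_delta t ^+ total_degree p * P.@[sphere_point t ord0] = p.@[t ord0].
Proof.
move=> [_ ->]; rewrite sphere_point0 ?invr_eq0 ?sqrt_delta_neq0 //.
rewrite mulrA -exprMn divff ?sqrt_delta_neq0 // expr1n mul1r.
apply: meval_eq => i.
by rewrite sphere_pointS invrK divfK ?sqrt_delta_neq0.
Qed.

Lemma eval_sqrtX t : eval_sqrt 'X_(rshift n ord0) t = sqrt_delta t.
Proof. by rewrite /eval_sqrt mevalXU row_mxEr mxE eqxx mulr1n. Qed.

(** Each coordinate has denominator sqrt Delta. For a sum, the two exponents are equalized by
    multiplying with powers of the last variable. *)
Lemma eval_sqrt_clear (u : {mpoly R[n.+1]}) : exists e v,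
  forall t, sqrt_delta t ^+ e * u.@[sphere_point t ord0] = eval_sqrt v t.
Proof.
elim/mpoly_ring_ind: u => [r|i|u1 u2|u1 u2].
- by exists 0%N, r%:MP => t; rewrite expr0 mul1r /eval_sqrt !mevalC.
- exists 1%N; case: (unliftP ord0 i) => [j|] ->.
    exists 'X_(lshift 1 j) => t; rewrite mevalXU sphere_pointS /eval_sqrt mevalXU.
    by rewrite row_mxEl expr1 mulrCA divff ?mulr1 // sqrt_delta_neq0.
  exists 1 => t; rewrite mevalXU sphere_point0 /eval_sqrt meval1.
  by rewrite expr1 divff // sqrt_delta_neq0.
- move=> [e1 [v1 h1]] [e2 [v2 h2]]; exists (e1 + e2)%N.
  exists ('X_(rshift n ord0) ^+ e2 * v1 + 'X_(rshift n ord0) ^+ e1 * v2) => t.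
  rewrite /eval_sqrt !mevalD !mevalM !rmorphXn /= -!/(eval_sqrt _ t) eval_sqrtX.
  by rewrite -h1 -h2 exprD; ring.
- move=> [e1 [v1 h1]] [e2 [v2 h2]]; exists (e1 + e2)%N, (v1 * v2) => t.
  by rewrite /eval_sqrt !mevalM -!/(eval_sqrt _ t) -h1 -h2 exprD; ring.
Qed.

Definition sqrt_weight (q r : {mpoly R[n + 1]}) t : R :=
  eval_sqrt q t ^+ 2 + Num.sqrt (sumsq1 t) * eval_sqrt r t ^+ 2.

(** Stated for functions of t, so that values at [sphere_point], which are not polynomial in t, can
    be handled directly. *)
Definition representable F : Prop :=
  exists (L : finType) (q r : L -> {mpoly R[n + 1]})
    (qk rk : 'I_m -> L -> {mpoly R[n + 1]}),
  forall t, F t = \sum_(l : L) sqrt_weight (q l) (r l) t +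
    \sum_(k < m) \sum_(l : L) (ps k).@[t ord0] * sqrt_weight (qk k l) (rk k l) t.

Lemma representable_ext F G : F =1 G -> representable F -> representable G.
Proof.
move=> FG [L [q [r [qk [rk h]]]]]; exists L, q, r, qk, rk => t.
by rewrite -FG.
Qed.

Lemma sqrt_weight0 t : sqrt_weight 0 0 t = 0.
Proof. by rewrite /sqrt_weight /eval_sqrt !meval0 expr0n mulr0 addr0. Qed.

Lemma sqrt_weight1 t : sqrt_weight 1 0 t = 1.
Proof. by rewrite /sqrt_weight /eval_sqrt meval1 meval0 expr0n mulr0 addr0 expr1n. Qed.

Lemma sqrt_weightM v q r t :
  sqrt_weight (v * q) (v * r) t = eval_sqrt v t ^+ 2 * sqrt_weight q r t.
Proof. by rewrite /sqrt_weight /eval_sqrt !mevalM; ring. Qed.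

Lemma sqrt_weight_sqrt q r t :
  sqrt_weight ('X_(rshift n ord0) * r) q t = sqrt_delta t * sqrt_weight q r t.
Proof.
rewrite /sqrt_weight {1}/eval_sqrt mevalM -!/(eval_sqrt _ t) eval_sqrtX.
rewrite -/(sqrt_delta t); ring.
Qed.

Lemma representable1 : representable (fun=> 1).
Proof.
exists unit, (fun=> 1), (fun=> 0), (fun _ _ => 0), (fun _ _ => 0) => t.
rewrite big_const card_unit /= sqrt_weight1 addr0.
rewrite big1 ?addr0 // => k _; rewrite big1 // => l _.
by rewrite sqrt_weight0 mulr0.
Qed.

Lemma representable_generator k : representable (fun t => (ps k).@[t ord0]).
Proof.
exists unit, (fun=> 0), (fun=> 0), (fun k' _ => (k' == k)%:R), (fun _ _ => 0) => t.
rewrite big1 ?add0r => [|l _]; last exact: sqrt_weight0.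
rewrite (bigD1 k) //= big_const card_unit /= eqxx sqrt_weight1 mulr1 addr0.
rewrite big1 ?addr0 // => j /negbTE ->; rewrite big1 // => l _.
by rewrite sqrt_weight0 mulr0.
Qed.

Lemma representableD F G :
  representable F -> representable G -> representable (fun t => F t + G t).
Proof.
move=> [L [q [r [qk [rk h]]]]] [L' [q' [r' [qk' [rk' h']]]]].
pose join (f : L -> {mpoly R[n + 1]}) (f' : L' -> {mpoly R[n + 1]}) (l : L + L') :=
  match l with inl i => f i | inr i => f' i end.
exists (L + L')%type, (join q q'), (join r r').
exists (fun k => join (qk k) (qk' k)), (fun k => join (rk k) (rk' k)) => t.
rewrite h h' big_sumType addrACA -big_split /=; congr (_ + _).
by apply: eq_bigr => k _; rewrite big_sumType.
Qed.

Lemma representable_sqrM v F :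
  representable F -> representable (fun t => eval_sqrt v t ^+ 2 * F t).
Proof.
move=> [L [q [r [qk [rk h]]]]]; exists L, (fun l => v * q l), (fun l => v * r l).
exists (fun k l => v * qk k l), (fun k l => v * rk k l) => t.
rewrite h mulrDr !mulr_sumr; congr (_ + _).
  by apply: eq_bigr => l _; rewrite sqrt_weightM.
apply: eq_bigr => k _; rewrite mulr_sumr.
by apply: eq_bigr => l _; rewrite sqrt_weightM mulrCA.
Qed.

Lemma representable_sqrtM e F :
  representable F -> representable (fun t => sqrt_delta t ^+ e * F t).
Proof.
move=> RF; elim: e => [|e [L [q [r [qk [rk h]]]]]].
  by apply: representable_ext RF => t; rewrite mul1r.
exists L, (fun l => 'X_(rshift n ord0) * r l), q.
exists (fun k l => 'X_(rshift n ord0) * rk k l), qk => t.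
rewrite exprS -mulrA h mulrDr !mulr_sumr; congr (_ + _).
  by apply: eq_bigr => l _; rewrite sqrt_weight_sqrt.
apply: eq_bigr => k _; rewrite mulr_sumr.
by apply: eq_bigr => l _; rewrite sqrt_weight_sqrt mulrCA.
Qed.

Definition sphere_module (a : {mpoly R[n.+1]}) : Prop :=
  exists N0, forall N, (N0 <= N)%N ->
    representable (fun t => sqrt_delta t ^+ N * a.@[sphere_point t ord0]).

(** Thresholds are combined by a maximum for sums. For u^2 a, the factor sqrt Delta ^ (2 e) turns
    u^2 into the square of a polynomial in t, sqrt Delta, so the threshold grows by 2 e. *)
Lemma sphere_qmodule : quadratic_module sphere_module.
Proof.
split.
- exists 0%N => N _; apply: representable_ext (representable_sqrtM N representable1).
  by move=> t; rewrite meval1.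
- move=> a b [Na ha] [Nb hb]; exists (maxn Na Nb) => N; rewrite geq_max.
  move=> /andP[/ha Ra /hb Rb]; apply: representable_ext (representableD Ra Rb).
  by move=> t; rewrite mevalD mulrDr.
- move=> u a [Na ha]; have [e [v hv]] := eval_sqrt_clear u.
  exists (Na + (e + e))%N => N hN.
  have eN : (e + e <= N)%N by apply: leq_trans hN; apply: leq_addl.
  have hN' : (Na <= N - (e + e))%N by rewrite leq_subRL // addnC.
  apply: representable_ext (representable_sqrM v (ha _ hN')) => t.
  rewrite -hv mevalM rmorphXn /=.
  have -> : N = (N - (e + e) + (e + e))%N by rewrite subnK.
  by rewrite addnK !exprD; ring.
Qed.

(** The zero function is representable. This places both signs of the equation of the sphere in the
    module. *)
Lemma sphere_module_vanish a :
  (forall t, a.@[sphere_point t ord0] = 0) -> sphere_module a.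
Proof.
move=> a0; exists 0%N => N _.
apply: representable_ext (representable_sqrM 0 representable1) => t.
by rewrite a0 /eval_sqrt meval0 expr0n mul0r mulr0.
Qed.

Lemma sphere_module_generator k (Pk : {mpoly R[n.+1]}) :
  is_homogenization (ps k) Pk -> sphere_module Pk.
Proof.
move=> hPk; exists (total_degree (ps k)) => N hN.
apply: representable_ext
  (representable_sqrtM (N - total_degree (ps k)) (representable_generator k)) => t.
by rewrite -(homogenization_sphere t hPk) mulrA -exprD subnK.
Qed.

Lemma sphere_equation_vanish t :
  (1 - \sum_(i < n.+1) 'X_i ^+ 2 : {mpoly R[n.+1]}).@[sphere_point t ord0] = 0.
Proof.
rewrite mevalB meval1 (rmorph_sum (meval _)) /=.
by under eq_bigr do rewrite rmorphXn /= mevalXU; rewrite sphere_point_norm subrr.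
Qed.

End Sphere.

(** * Putinar's theorem on the sphere, and the return to p *)

Unset Implicit Arguments.

Theorem theorem4p5 (R : realType) (n : nat) (hn : (1 <= n)%N) (m : nat)
    (ps : 'I_m -> {mpoly R[n]}) (p : {mpoly R[n]})
    (Ps : 'I_m -> {mpoly R[n.+1]}) (P : {mpoly R[n.+1]})
    (hPs : forall k : 'I_m, is_homogenization (ps k) (Ps k))
    (hP : is_homogenization p P)
    (hpos : forall x : 'rV[R]_n.+1,
      (forall k : 'I_m, 0 <= (Ps k).@[x ord0]) -> x != 0 -> 0 < P.@[x ord0]) :
  exists (b : nat) (L : finType)
    (q r : L -> {mpoly R[n + 1]}) (qk rk : 'I_m -> L -> {mpoly R[n + 1]}),
    forall t : 'rV[R]_n,
      sumsq1 t ^+ b * p.@[t ord0] =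
      \sum_(l : L) (eval_sqrt (q l) t ^+ 2 +
                    Num.sqrt (sumsq1 t) * eval_sqrt (r l) t ^+ 2) +
      \sum_(k < m) \sum_(l : L)
        (ps k).@[t ord0] * (eval_sqrt (qk k l) t ^+ 2 +
                            Num.sqrt (sumsq1 t) * eval_sqrt (rk k l) t ^+ 2).
Proof.
have qM := sphere_qmodule ps.
pose h : {mpoly R[n.+1]} := 1 - \sum_(i < n.+1) 'X_i ^+ 2.
have Mh : sphere_module ps h.
  exact/sphere_module_vanish/sphere_equation_vanish.
have MNh : sphere_module ps (- h).
  by apply: sphere_module_vanish => t; rewrite mevalN sphere_equation_vanish oppr0.
(* This exponent is at least [N0]. The part [total_degree p] turns P into p, and the rest is sqrt
   Delta ^ (2 N0) = Delta ^ N0, so that b = N0. *)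
have [N0 /(_ (N0 * 2 + total_degree p)%N)] : sphere_module ps P.
  apply: (archimedean_positivstellensatz qM (ball_archimedean qM Mh)) => v Mv.
  pose x : 'rV[R]_n.+1 := \row_i v i.
  have xv : x ord0 =1 v by move=> i; rewrite mxE.
  rewrite -(meval_eq _ xv); apply: hpos => [k|].
    by rewrite (meval_eq _ xv); apply/Mv/sphere_module_generator.
  apply/eqP => x0.
  have v0 i : v i = 0 by rewrite -xv x0 mxE.
  (* At the origin [- h] takes the value -1, so its membership in the module excludes v = 0. *)
  have := Mv _ MNh; rewrite mevalN mevalB meval1 (rmorph_sum (meval _)) /= big1 => [|i _].
    by rewrite subr0 oppr_ge0 ler10.
  by rewrite rmorphXn /= mevalXU v0 expr0n.
case=> [|L [q [r [qk [rk e]]]]].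
  by rewrite muln2 -addnn -addnA leq_addr.
exists N0, L, q, r, qk, rk => t.
rewrite -[in LHS]sqrt_delta_sqr -exprM -(homogenization_sphere t hP).
by rewrite mulrA -exprD mulnC e.
Qed.
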